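(* Let $f$ be a real function infinitely differentiable at $0$ whose Maclaurin series has radius of convergence $R>0$ (possibly $R=\infty$) and converges to $f$ on $(-R,R)$, and suppose $f(0)\ge0$ and $f^{(k)}(0)\ge0$ for all $k\in\mathbb N$. Let $0<a_1<\cdots<a_n$ and define $f_r(x):=f(a_r x)$, $r=1,\dots,n$. Then the system $\mathbf f=(f_1,\dots,f_n)$ is totally positive on $(0,R/a_n)$: for every $x_1<\cdots<x_n$ in $(0,R/a_n)$ the collocation matrix $(f_c(x_r))_{r,c=1}^n$ is totally positive (all its minors are nonnegative). *)

(* Defs.v *)
#[export] Set Warnings "-notation-overridden,-notation-incompatible-prefix".
From mathcomp Require Export all_boot all_order all_algebra.
From mathcomp Require Export all_classical all_reals all_analysis.
Export numFieldNormedType.Exports.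

Set Implicit Arguments.
Unset Strict Implicit.
Unset Printing Implicit Defensive.

Import Order.TTheory GRing.Theory Num.Theory.

Local Open Scope classical_set_scope.
Local Open Scope ring_scope.

(* Derivatives are total in the library, so existence is asserted explicitly:
   every iterated derivative is itself differentiable on a neighbourhood
   (depending on [k]) of [a]. *)
Definition infinitely_differentiable_at (R : realType) (f : R -> R) (a : R) :
    Prop :=
  forall k : nat, \forall x \near a, derivable (f^`(k))%classic x 1.

Definition maclaurin_coeff (R : realType) (f : R -> R) : R^nat :=
  fun k => (f^`(k))%classic 0 / k`!%:R.

Definition radius_of_convergence (R : realType) (c : R^nat) : \bar R :=
  ereal_sup [set `|z|%:E | z in [set z : R | cvgn (pseries c z)]].

(* The minors are indexed by strictly increasing choices of [k] rows and [k]
   columns; the empty minor [k = 0] equals 1 and is harmless. *)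
Definition totally_positive_mx (R : realType) (m n : nat) (A : 'M[R]_(m, n)) :
    Prop :=
  forall (k : nat) (p : 'I_k -> 'I_m) (q : 'I_k -> 'I_n),
    (forall i j : 'I_k, (i < j)%N -> (p i < p j)%N) ->
    (forall i j : 'I_k, (i < j)%N -> (q i < q j)%N) ->
    0 <= \det (mxsub p q A).

Definition collocation_mx (R : realType) (m n : nat) (u : 'I_n -> R -> R)
    (x : 'I_m -> R) : 'M[R]_(m, n) :=
  \matrix_(r, c) u c (x r).

Definition totally_positive_system (R : realType) (n : nat)
    (u : 'I_n -> R -> R) (D : set R) : Prop :=
  forall x : 'I_n -> R,
    (forall i, D (x i)) ->
    (forall i j : 'I_n, (i < j)%N -> x i < x j) ->
    totally_positive_mx (collocation_mx u x).

(* Main.v *)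
(* By Cauchy-Binet, a minor of the collocation matrix of a partial sum of the
   series is a nonnegative combination of products of two generalized Vandermonde
   determinants det (x_i ^ s_j) and det (a_i ^ s_j) with the same exponents s.
   Such a determinant does not vanish at increasing positive nodes, so it has the
   same sign at all of them and each product is nonnegative.  Minors depend
   continuously on the entries, which gives the result in the limit. *)
Require Import Defs.
From mathcomp Require Import perm.
From mathcomp Require polyrcf.

Set Implicit Arguments.
Unset Strict Implicit.
Unset Printing Implicit Defensive.

Import Order.TTheory GRing.Theory Num.Theory.

Local Open Scope classical_set_scope.
Local Open Scope ring_scope.

(* Dividing by the lowest power and applying Rolle's theorem removes one term
   and one root. *)
Lemma sparse_poly_eq0 (F : rcfType) (k : nat) (s : 'I_k -> nat)
    (c x : 'I_k -> F) :
  injective s -> (forall i, 0 < x i) ->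
  (forall i j : 'I_k, (i < j)%N -> x i < x j) ->
  (forall i, \sum_j c j * x i ^+ s j = 0) -> forall j, c j = 0.
Proof.
elim: k s c x => [|k IHk] s c x s_inj x_gt0 x_incr cx0; first by case.
have [i0 _ s_min] := @arg_minnP _ ord0 xpredT s isT.
pose e j := (s j - s i0)%N.
have sE j : s j = (e j + s i0)%N by rewrite subnK ?s_min.
pose p := \sum_j c j *: 'X^(e j) : {poly F}.
have pE y : p.[y] = \sum_j c j * y ^+ e j.
  by rewrite horner_sum; apply: eq_bigr => j _; rewrite hornerZ hornerXn.
have px0 i : p.[x i] = 0.
  apply: (mulIf (expf_neq0 (s i0) (lt0r_neq0 (x_gt0 i)))).
  rewrite mul0r -[RHS](cx0 i) pE mulr_suml; apply: eq_bigr => j' _.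
  by rewrite -mulrA -exprD -sE.
have root_between i :
    {y | y \in `]x (widen_ord (leqnSn k) i), x (lift ord0 i)[ & p^`().[y] = 0}.
  by apply: polyrcf.poly_rolle; rewrite ?px0 //; apply: x_incr; rewrite /= /bump.
pose y i := s2val (root_between i).
have yP i : x (widen_ord (leqnSn k) i) < y i < x (lift ord0 i).
  by have := s2valP (root_between i); rewrite in_itv.
have e0 : e i0 = 0%N by rewrite /e subnn.
have e_gt0 j : (0 < e (lift i0 j))%N.
  by rewrite subn_gt0 ltn_neqAle s_min // (inj_eq s_inj) neq_lift.
(* The derivative of [p] has only [k] terms, since the constant one at [i0] dies, and it vanishes at
   the [k] Rolle points [y]; induction kills its coefficients. *)
have c'0 (j : 'I_k) : c (lift i0 j) * (e (lift i0 j))%:R = 0.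
  apply: (IHk (fun j => (e (lift i0 j)).-1)
              (fun j => c (lift i0 j) * (e (lift i0 j))%:R) y).
  - move=> j1 j2 /= eq_e; apply: (@lift_inj _ i0); apply: s_inj.
    by rewrite (sE (lift i0 j1)) (sE (lift i0 j2))
      -(prednK (e_gt0 j1)) eq_e prednK.
  - by move=> i; case/andP: (yP i) => /(lt_trans (x_gt0 _)).
  - move=> i1 i2 lt_i12.
    (* The chain is [y i1 < x (i1 + 1) <= x i2 < y i2], with equality in the middle when the indices
       are consecutive. *)
    case/andP: (yP i1) => _ /lt_le_trans; apply.
    case/andP: (yP i2) => /ltW + _; apply: le_trans.
    have [->//|ne_i12] := eqVneq (lift ord0 i1) (widen_ord (leqnSn k) i2).
    by apply/ltW/x_incr; rewrite ltn_neqAle ne_i12.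
  - move=> i; rewrite -[RHS](s2valP' (root_between i)) -/(y i).
    rewrite raddf_sum horner_sum (bigD1_ord i0) //= e0 derivZ.
    rewrite derivXn mulr0n scaler0 horner0 add0r; apply: eq_bigr => j' _.
    by rewrite derivZ derivXn hornerZ hornerMn hornerXn -mulrA mulr_natl.
have c0 j : j != i0 -> c j = 0.
  case: (unliftP i0 j) => [j' ->|-> /eqP//] _.
  by have /eqP := c'0 j'; rewrite mulf_eq0 pnatr_eq0 eqn0Ngt e_gt0 orbF => /eqP.
move=> j; have [->|/c0 //] := eqVneq j i0.
(* With all other coefficients zero, [p] is the constant [c i0], and it has a root. *)
have := px0 ord0; rewrite pE (bigD1 i0) //= big1 ?addr0 => [|j' /c0->].
  by rewrite e0 expr0 mulr1.
by rewrite mul0r.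
Qed.

(** A kernel vector would be the coefficients of a polynomial with [k] terms and [k] positive
    roots. *)
Lemma generalized_vandermonde_neq0 (F : rcfType) (k : nat) (s : 'I_k -> nat)
    (x : 'I_k -> F) :
  injective s -> (forall i, 0 < x i) ->
  (forall i j : 'I_k, (i < j)%N -> x i < x j) ->
  \det (\matrix_(i, j) x i ^+ s j) != 0.
Proof.
move=> s_inj x_gt0 x_incr; rewrite -det_tr; apply/det0P => -[v /eqP v0 vA0].
apply: v0; apply/rowP => j; rewrite mxE.
apply: (sparse_poly_eq0 (c := v 0) s_inj x_gt0 x_incr) => i.
have /rowP/(_ i) := vA0; rewrite !mxE => vA0i; rewrite -[RHS]vA0i.
by apply: eq_bigr => l _; rewrite !mxE.
Qed.

(* The determinant never vanishes along the segment joining the two node sets,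
   so it keeps its sign. *)
Lemma generalized_vandermonde_mul_ge0 (F : rcfType) (k : nat)
    (s : 'I_k -> nat) (x y : 'I_k -> F) :
  (forall i, 0 < x i) -> (forall i, 0 < y i) ->
  (forall i j : 'I_k, (i < j)%N -> x i < x j) ->
  (forall i j : 'I_k, (i < j)%N -> y i < y j) ->
  0 <= \det (\matrix_(i, j) x i ^+ s j) * \det (\matrix_(i, j) y i ^+ s j).
Proof.
move=> x_gt0 y_gt0 x_incr y_incr.
(* A repeated exponent gives two equal columns, so the product is zero. *)
have [/injectiveP s_inj|/injectivePn[j1 [j2 ne_j12 eq_s]]] :=
  boolP (injectiveb s); last first.
  rewrite -det_tr (determinant_alternate ne_j12) ?mul0r // => i.
  by rewrite !mxE eq_s.
(* As a function of the segment parameter the determinant is a polynomial, so the intermediate value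
   theorem holds for it over any real closed field. *)
pose p := \det (\matrix_(i, j) ((x i)%:P * (1 - 'X) + (y i)%:P * 'X) ^+ s j).
have pE t : p.[t] = \det (\matrix_(i, j) (x i * (1 - t) + y i * t) ^+ s j).
  rewrite -[LHS]/(horner_eval t p) -det_map_mx; congr (\det _).
  apply/matrixP => i j.
  by rewrite !mxE -[LHS]/(_.[t]) !hornerE.
have p0 : p.[0] = \det (\matrix_(i, j) x i ^+ s j).
  by rewrite pE; congr (\det _); apply/matrixP => i j;
     rewrite !mxE subr0 mulr1 mulr0 addr0.
have p1 : p.[1] = \det (\matrix_(i, j) y i ^+ s j).
  by rewrite pE; congr (\det _); apply/matrixP => i j;
     rewrite !mxE subrr mulr0 mulr1 add0r.
rewrite -p0 -p1 leNgt; apply/negP => /ltW/(polyrcf.poly_ivt ler01)[t].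
rewrite in_itv /= => /andP[t_ge0 t_le1]; rewrite rootE pE.
have convex_gt0 (u v : F) : 0 < u -> 0 < v -> 0 < u * (1 - t) + v * t.
  move=> u_gt0 v_gt0.
  move: t_le1; rewrite le_eqVlt => /predU1P[->|lt_t1].
    by rewrite subrr mulr0 mulr1 add0r.
  by rewrite ltr_pwDl ?mulr_gt0 ?subr_gt0 // mulr_ge0 // ltW.
apply/negP; apply: generalized_vandermonde_neq0 => // [i|i j lt_ij].
  exact: convex_gt0.
rewrite -subr_gt0.
have -> : x j * (1 - t) + y j * t - (x i * (1 - t) + y i * t) =
    (x j - x i) * (1 - t) + (y j - y i) * t
  by rewrite opprD addrACA -!mulrBl.
by rewrite convex_gt0 ?subr_gt0 ?x_incr ?y_incr.
Qed.

(* Cauchy-Binet with the subsets of columns replaced by all functions: each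
   subset is then counted k`! times, and non-injective functions contribute 0. *)
Lemma det_mulmx_sum_sub (A : comNzRingType) (k m : nat) (M : 'M[A]_(k, m))
    (N : 'M[A]_(m, k)) :
  \det (M *m N) *+ k`! =
  \sum_(f : {ffun 'I_k -> 'I_m}) \det (colsub f M) * \det (rowsub f N).
Proof.
(* Expanding by multilinearity, [f] records the summation index chosen in each row. *)
have detE : \det (M *m N) =
    \sum_(f : {ffun 'I_k -> 'I_m}) (\prod_i M i (f i)) * \det (rowsub f N).
  transitivity (\sum_(s : 'S_k) \sum_(f : {ffun 'I_k -> 'I_m})
      (-1) ^+ s * \prod_i (M i (f i) * N (f i) (s i))).
    apply: eq_bigr => s _; rewrite -big_distrr /=; congr (_ * _).
    rewrite -(bigA_distr_bigA (fun i j => M i j * N j (s i))) /=.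
    by apply: eq_bigr => i _; rewrite mxE.
  rewrite exchange_big; apply: eq_bigr => f _ /=.
  rewrite /determinant big_distrr /=; apply: eq_bigr => s _.
  rewrite big_split /= mulrCA; congr (_ * (_ * _)).
  by apply: eq_bigr => i _; rewrite mxE.
under [RHS]eq_bigr => f _ do rewrite {1}/determinant mulr_suml.
(* The factorial becomes a sum over permutations. For each [s], substituting the composite of [f]
   with [s] permutes the rows of [rowsub f N], which produces exactly the sign of [s]. *)
rewrite exchange_big /=  -card_Sn -sumr_const.
apply: eq_bigr => s _; rewrite detE.
pose h (t : 'S_k) (f : {ffun 'I_k -> 'I_m}) := [ffun i => f (t i)].
have hK t : cancel (h t) (h t^-1%g).
  by move=> f; apply/ffunP => i; rewrite !ffunE permKV.
rewrite (reindex_inj (can_inj (hK s))); apply: eq_bigr => f _ /=.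
have -> : rowsub (h s f) N = row_perm s (rowsub f N).
  by apply/matrixP => i j; rewrite !mxE ffunE.
rewrite row_permE det_mulmx det_perm.
rewrite mulrCA mulrA; congr (_ * _ * _).
by apply: eq_bigr => i _; rewrite mxE ffunE.
Qed.

Lemma cvg_det (F : numFieldType) (T : Type) (FF : set_system T) (k : nat)
    (M : T -> 'M[F]_k) (L : 'M[F]_k) :
  Filter FF -> (forall i j, M t i j @[t --> FF] --> L i j) ->
  \det (M t) @[t --> FF] --> \det L.
Proof.
move=> filterFF cvgM; apply: cvg_big => [|s _]; first exact: add_continuous.
apply: cvgMl_tmp; apply: cvg_big => [|i _]; first exact: mul_continuous.
exact: cvgM.
Qed.

Lemma det_power_sum_ge0 (F : rcfType) (k m : nat) (c : nat -> F)
    (x y : 'I_k -> F) :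
  (forall l, 0 <= c l) -> (forall i, 0 < x i) -> (forall i, 0 < y i) ->
  (forall i j : 'I_k, (i < j)%N -> x i < x j) ->
  (forall i j : 'I_k, (i < j)%N -> y i < y j) ->
  0 <= \det (\matrix_(i, j) \sum_(l < m) c l * (y j * x i) ^+ l).
Proof.
move=> c_ge0 x_gt0 y_gt0 x_incr y_incr.
pose M := \matrix_(i < k, l < m) x i ^+ l.
pose N := \matrix_(l < m, j < k) (c l * y j ^+ l).
have -> : \matrix_(i, j) (\sum_(l < m) c l * (y j * x i) ^+ l) = M *m N.
  apply/matrixP => i j; rewrite !mxE; apply: eq_bigr => l _.
  by rewrite !mxE exprMn [RHS]mulrC mulrA.
rewrite -(pmulrn_lge0 _ (fact_gt0 k)) det_mulmx_sum_sub sumr_ge0 // => f _.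
have -> : colsub f M = \matrix_(i, j) x i ^+ f j.
  by apply/matrixP => i j; rewrite !mxE.
(* The nonnegative weights split off as a diagonal factor. *)
have -> : rowsub f N =
    diag_mx (\row_i c (f i)) *m (\matrix_(i, j) y i ^+ f j)^T.
  by apply/matrixP => i j; rewrite mul_diag_mx !mxE.
rewrite det_mulmx det_diag det_tr mulrCA mulr_ge0 //.
  by apply: prodr_ge0 => i _; rewrite mxE.
exact: generalized_vandermonde_mul_ge0.
Qed.

Theorem theorem5 (R : realType) (f : R -> R) (rho : \bar R)
    (hsmooth : infinitely_differentiable_at f 0)
    (hrho : radius_of_convergence (maclaurin_coeff f) = rho)
    (hrho_gt0 : (0 < rho)%E)
    (hf : forall x : R, (`|x|%:E < rho)%E ->
       pseries (maclaurin_coeff f) x @ \oo --> f x)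
    (hf0 : 0 <= f 0)
    (hfk : forall k : nat, 0 <= (f^`(k))%classic 0)
    (n : nat) (a : 'I_n.+1 -> R)
    (ha_gt0 : 0 < a ord0)
    (ha_incr : forall i j : 'I_n.+1, (i < j)%N -> a i < a j) :
  totally_positive_system (fun r x => f (a r * x))
    [set x : R | 0 < x /\ (x%:E < rho / (a ord_max)%:E)%E].
Proof.
move=> x xD x_incr k p q p_incr q_incr.
have x_gt0 i : 0 < x i by case: (xD i).
have a_gt0 j : 0 < a j.
  have [->//|j_neq0] := eqVneq j ord0.
  by apply: lt_trans ha_gt0 (ha_incr _ _ _); rewrite lt0n.
have cvg_f i j : pseries (maclaurin_coeff f) (a j * x i) @ \oo -->
    f (a j * x i).
  (* The bound is [a j * x i <= a ord_max * x i < rho]. *)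
  apply: hf; rewrite ger0_norm ?mulr_ge0 ?ltW //.
  case: (xD i) => _; rewrite inver gt_eqF // lte_pdivlMr // -EFinM mulrC.
  apply: le_lt_trans; rewrite lee_fin ler_pM2r //.
  have [->//|j_neq] := eqVneq j ord_max.
  apply/ltW/ha_incr; rewrite ltn_neqAle -ltnS ltn_ord andbT.
  exact: j_neq.
pose S m := \matrix_(i < k, j < k)
  \sum_(l < m) maclaurin_coeff f l * (a (q j) * x (p i)) ^+ l.
(* Nonnegativity of the truncated minors passes to the limit. *)
apply: (@cvgr_to_ge _ \oo _ _ (fun m => \det (S m))).
  apply: cvg_det => i j; rewrite !mxE; under eq_fun do rewrite mxE.
  have := cvg_f (p i) (q j); apply: cvg_trans; apply: near_eq_cvg.
  by near=> m; rewrite /pseries /series /= big_mkord.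
near=> m; apply: det_power_sum_ge0 => [l|i|i|i j lt_ij|i j lt_ij] //.
- by rewrite divr_ge0.
- exact/x_incr/p_incr.
- exact/ha_incr/q_incr.
Unshelve. all: by end_near. Qed.
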